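(* Let $R$ be a Noetherian local ring with maximal ideal $\mathfrak{m}$, and set $F := R/\mathfrak{m}$ and $S := R[x_1, \ldots, x_n]$. Let $G \subseteq GL_n(R)$ be a finite group. If $F$ has infinitely many elements, then $S^G$ contains a homogeneous system of parameters consisting of elements of degree at most $|G|$.
   Context: All rings are commutative. The polynomial ring $S=R[x_1,\ldots,x_n]$ is $\mathbb{N}$-graded with $\deg(x_i)=1$ and degree-zero part $R$. A subgroup $G \subseteq GL_n(R)$ acts on $S$ by $R$-algebra automorphisms via $\sigma(f) = f(\sigma^{-1}(x_1,\ldots,x_n))$ for $\sigma \in G$, and $S^G$ is the graded subring of invariants. For a finitely generated $\mathbb{N}$-graded $R$-algebra $T$ with $T_0 \cong R$, a sequence $f_1,\ldots,f_m$ of homogeneous elements of $T$ is called a homogeneous system of parameters if $f_1,\ldots,f_m$ are algebraically independent over $R$ and $T$ is finitely generated as a module over $R[f_1,\ldots,f_m]$. *)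

(* Defs.v *)
From HB Require Import structures.
From mathcomp Require Import all_boot all_order all_algebra.
From mathcomp Require Import ring_quotient.
From mathcomp Require Import finmap.
From mathcomp Require Export mpoly.

Set Implicit Arguments.
Unset Strict Implicit.
Unset Printing Implicit Defensive.

Import GRing.Theory.
Local Open Scope ring_scope.

Section Rings.
Variable R : comUnitRingType.

Definition is_ideal (I : R -> Prop) : Prop :=
  I 0 /\ forall a u v, I u -> I v -> I (a * u + v).

Definition noetherian : Prop :=
  forall I : R -> Prop, is_ideal I ->
  exists s : seq R, forall x,
    I x <-> exists c : 'I_(size s) -> R, x = \sum_(i < size s) c i * s`_i.

(* [idealr R] is the type of proper ideals given by boolean predicates;
   under classical logic these are all the proper ideals of R. *)
Definition maximal_ideal (m : idealr R) : Prop :=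
  forall J : idealr R, {subset m <= J} -> J =i m.

Definition local_ring_with (m : idealr R) : Prop :=
  maximal_ideal m /\ forall m' : idealr R, maximal_ideal m' -> m' =i m.

End Rings.

Definition infinite_type (T : eqType) : Prop :=
  forall s : seq T, exists x : T, x \notin s.

Section Invariants.
Variables (R : comUnitRingType) (n : nat).
Local Notation S := {mpoly R[n]}.

Definition GL_subgroup (G : {fset 'M[R]_n}) : Prop :=
  [/\ {in G, forall A, A \in unitmx},
      1%:M \in G,
      {in G &, forall A B, A *m B \in G}
    & {in G, forall A, invmx A \in G}].

(* sigma(f) = f(sigma^-1 (x_1, ..., x_n)), where sigma^-1 multiplies the
   column vector of the variables. *)
Definition mxact (A : 'M[R]_n) (f : S) : S :=
  f \mPo [tuple \sum_(j < n) invmx A i j *: 'X_j | i < n].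

Definition invariants (G : {fset 'M[R]_n}) (f : S) : Prop :=
  {in G, forall A, mxact A f = f}.

Definition alg_independent m (f : m.-tuple S) : Prop :=
  forall p : {mpoly R[m]}, p \mPo f = 0 -> p = 0.

(* T is generated, as a module over R[f_1, ..., f_m], by finitely many elements;
   the elements of R[f_1, ..., f_m] are the values p(f_1, ..., f_m). *)
Definition finite_over (T : S -> Prop) m (f : m.-tuple S) : Prop :=
  exists s : seq S,
    (forall g, g \in s -> T g) /\
    forall g, T g -> exists c : 'I_(size s) -> {mpoly R[m]},
      g = \sum_(i < size s) (c i \mPo f) * s`_i.

(* Here T is a graded R-subalgebra of S with degree-zero part R. That T is a
   finitely generated R-algebra follows from [finite_over]. *)
Definition hsop (T : S -> Prop) m (f : m.-tuple S) : Prop :=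
  [/\ forall i, T (tnth f i),
      forall i, exists d, tnth f i \is d.-homog,
      alg_independent f
    & finite_over T f].

End Invariants.

(* Main.v *)
Require Import Defs.
From HB Require Import structures.
From mathcomp Require Import all_boot all_order all_algebra.
From mathcomp Require Import ring_quotient finmap mpoly.
From mathcomp Require Import generic_quotient ring zify.
From mathcomp Require boolp classical_sets.

(* For linear forms l_1, ..., l_n, let f_i be the product of the |G| forms A l_i
   (A in G), an invariant of degree |G|.  Since the residue field is infinite,
   the l_i can be chosen so that for all A_1, ..., A_n in G the forms A_1 l_1,
   ..., A_n l_n are an R-basis of the linear forms: each tuple (A_i) asks that
   one determinant be a unit, and each of these finitely many conditions can be
   met separately.  Every such basis is a regular sequence in any order, and
   every variable lies in the radical of the ideal it generates.  Both
   properties are multiplicative in each entry, so the f_i inherit them.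
   Regularity makes the f_i algebraically independent over R; the radical
   property and homogeneity make S a finite module over the Noetherian ring
   R[f_1, ..., f_n], hence so is its submodule S^G. *)

Set Implicit Arguments.
Unset Strict Implicit.
Unset Printing Implicit Defensive.

Import GRing.Theory.
Local Open Scope ring_scope.

(** * Finite modules over subrings and the Noetherian property *)

Section Span.
Variable C : comNzRingType.
Implicit Types (A U : C -> Prop) (s t : seq C) (a b c g u v x y : C).

Definition subring A : Prop :=
  [/\ A 1, forall a b, A a -> A b -> A (a - b)
    & forall a b, A a -> A b -> A (a * b)].

Definition submodule A U : Prop :=
  U 0 /\ forall a u v, A a -> U u -> U v -> U (a * u + v).

(** Peeling off one coefficient at a time lets inductions on [s] run without indexed sums;
    [span_sumP] recovers the sum. *)
Fixpoint in_span A s g : Prop :=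
  if s is x :: s' then exists2 a, A a & in_span A s' (g - a * x) else g = 0.

(** Phrased for submodules of finitely generated modules rather than for ideals of [A]: in the end
    it is applied to the invariants as a submodule of the polynomial ring. *)
Definition noetherian_sub A : Prop :=
  forall U s, submodule A U -> (forall g, U g -> in_span A s g) ->
  exists t, (forall x, x \in t -> U x) /\ forall g, U g -> in_span A t g.

Definition adjoin A c g : Prop :=
  exists k, in_span A [seq c ^+ j | j <- iota 0 k] g.

Lemma span_mono A A' s g :
  (forall a, A a -> A' a) -> in_span A s g -> in_span A' s g.
Proof.
move=> sAA'; elim: s g => //= x s IHs g [a Aa Hg].
by exists a; [exact: sAA' | exact: IHs].
Qed.

Section Subring.
Variable A : C -> Prop.
Hypothesis subA : subring A.

Lemma subring1 : A 1. Proof. by case: subA. Qed.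
Lemma subringB a b : A a -> A b -> A (a - b).
Proof. by case: subA => _ + _; apply. Qed.
Lemma subringM a b : A a -> A b -> A (a * b).
Proof. by case: subA => _ _; apply. Qed.
Lemma subring0 : A 0.
Proof. by rewrite -(subrr 1); apply: subringB subring1 subring1. Qed.
Lemma subringN a : A a -> A (- a).
Proof. by move=> Aa; rewrite -sub0r; apply: subringB subring0 Aa. Qed.
Lemma subringD a b : A a -> A b -> A (a + b).
Proof. by move=> Aa Ab; rewrite -[b]opprK; apply: subringB => //; apply: subringN. Qed.
Lemma subringX a k : A a -> A (a ^+ k).
Proof.
move=> Aa; elim: k => [|k IHk]; first exact: subring1.
by rewrite exprS; apply: subringM.
Qed.

Lemma submoduleD U u v : submodule A U -> U u -> U v -> U (u + v).
Proof. by case=> _ UD Uu Uv; rewrite -[u]mul1r; apply: UD => //; apply: subring1. Qed.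
Lemma submoduleM U a u : submodule A U -> A a -> U u -> U (a * u).
Proof. by case=> U0 UD Aa Uu; rewrite -[_ * _]addr0; apply: UD. Qed.
Lemma submoduleN U u : submodule A U -> U u -> U (- u).
Proof. move=> sU Uu; rewrite -mulN1r; apply: submoduleM => //.
by apply: subringN; apply: subring1. Qed.
Lemma submoduleB U u v : submodule A U -> U u -> U v -> U (u - v).
Proof. by move=> sU Uu Uv; apply: submoduleD => //; apply: submoduleN. Qed.

Lemma span_submodule s : submodule A (in_span A s).
Proof.
elim: s => [|x s [IH0 IHD]] /=; split=> //.
- by move=> a u v _ -> ->; rewrite mulr0 addr0.
- by exists 0; [apply: subring0 | rewrite mul0r subr0].
move=> a u v Aa [b Ab Hu] [c Ac Hv]; exists (a * b + c).
  by apply: subringD => //; apply: subringM.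
have -> : a * u + v - (a * b + c) * x = a * (u - b * x) + (v - c * x) by ring.
exact: IHD.
Qed.

Lemma mem_span s x : x \in s -> in_span A s x.
Proof.
elim: s => //= y s IHs; rewrite inE => /predU1P[->|/IHs Hx].
  by exists 1; [apply: subring1 | rewrite mul1r subrr; case: (span_submodule s)].
by exists 0; [apply: subring0 | rewrite mul0r subr0].
Qed.

Lemma span_min U s g :
  submodule A U -> (forall x, x \in s -> U x) -> in_span A s g -> U g.
Proof.
move=> sU; elim: s g => [|x s IHs] g sU' /=; first by move->; case: sU.
case=> a Aa Hg; rewrite -(subrK (a * x) g) addrC.
apply: sU.2 => //; first by apply: sU'; rewrite inE eqxx.
by apply: IHs Hg => y ys; apply: sU'; rewrite inE ys orbT.
Qed.

Lemma span_trans s t g :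
  (forall x, x \in s -> in_span A t x) -> in_span A s g -> in_span A t g.
Proof. by apply: span_min; apply: span_submodule. Qed.

Lemma span_sub s t g : {subset s <= t} -> in_span A s g -> in_span A t g.
Proof. by move=> sst; apply: span_trans => x /sst/mem_span. Qed.

Lemma span_sumP s g :
  in_span A s g ->
  exists c : 'I_(size s) -> C,
    (forall i, A (c i)) /\ g = \sum_(i < size s) c i * s`_i.
Proof.
elim: s g => [|x s IHs] g /=.
  by move->; exists (fun _ => 0); split=> [i|]; rewrite ?big_ord0 //; apply: subring0.
case=> a Aa /IHs[c [Ac Hg]].
exists (fun i => if unlift ord0 i is Some j then c j else a); split=> [i|].
  by case: unliftP.
rewrite big_ord_recl unlift_none /= -[LHS](subrK (a * x)) Hg addrC; congr (_ + _).
by apply: eq_bigr => i _; rewrite liftK.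
Qed.

End Subring.

Section Adjoin.
Variable A : C -> Prop.
Hypothesis subA : subring A.

Section Generator.
Variable c : C.

Lemma span_powers_leq k k' g :
  (k <= k')%N -> in_span A [seq c ^+ j | j <- iota 0 k] g ->
  in_span A [seq c ^+ j | j <- iota 0 k'] g.
Proof.
move=> le_kk'; apply: (span_sub subA) => _ /mapP[j + ->].
by rewrite mem_iota => ltj; apply: map_f; rewrite mem_iota; lia.
Qed.

Lemma adjoin_submodule : submodule A (adjoin A c).
Proof.
split=> [|a u v Aa [k Hu] [k' Hv]]; first by exists 0%N.
exists (maxn k k'); case: (span_submodule subA [seq c ^+ j | j <- iota 0 (maxn k k')]).
move=> _; apply=> //; [apply: span_powers_leq Hu | apply: span_powers_leq Hv]; lia.
Qed.

Lemma adjoinX j : adjoin A c (c ^+ j).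
Proof. by exists j.+1; apply/(mem_span subA)/map_f; rewrite mem_iota; lia. Qed.

Lemma sub_adjoin a : A a -> adjoin A c a.
Proof.
move=> Aa; rewrite -[a]mulr1; apply: (submoduleM adjoin_submodule) => //.
exact: (adjoinX 0).
Qed.

Lemma adjoin_min U g :
  submodule A U -> (forall j, U (c ^+ j)) -> adjoin A c g -> U g.
Proof. by move=> sU UX [k]; apply: span_min => // _ /mapP[j _ ->]. Qed.

Lemma submodule_mull U x : submodule A U -> submodule A (fun y => U (y * x)).
Proof.
move=> [U0 UD]; split=> [|a u v Aa Uu Uv]; first by rewrite mul0r.
by rewrite mulrDl -mulrA; apply: UD.
Qed.

Lemma adjoin_subring : subring (adjoin A c).
Proof.
split=> [|a b|a b]; first exact: (adjoinX 0).
  exact: (submoduleB subA adjoin_submodule).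
move=> Ha Hb; apply: (@adjoin_min (fun x => adjoin A c (x * b)) a) => // [|i].
  exact: (submodule_mull _ adjoin_submodule).
rewrite mulrC; apply: (@adjoin_min (fun x => adjoin A c (x * _)) b) => // [|j].
  exact: (submodule_mull _ adjoin_submodule).
by rewrite -exprD; apply: adjoinX.
Qed.

Variable s : seq C.

(** Polynomials in [c] of degree below [d] with coefficients in the module spanned by [s]. Since [c]
    may be algebraic over [A], such an expression need not be unique. *)
Definition span_lt d := in_span A [seq c ^+ j * x | j <- iota 0 d, x <- s].

Lemma span_lt_submodule d : submodule A (span_lt d).
Proof. exact: (span_submodule subA). Qed.

Lemma mem_span_lt d j x : (j < d)%N -> x \in s -> span_lt d (c ^+ j * x).
Proof.
by move=> ltjd xs; apply/(mem_span subA)/allpairsP; exists (j, x); rewrite mem_iota.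
Qed.

Lemma span_lt_min d U g : submodule A U ->
  (forall j x, (j < d)%N -> x \in s -> U (c ^+ j * x)) -> span_lt d g -> U g.
Proof.
move=> sU HU; apply: span_min => // _ /allpairsP[[j x] [/= + xs ->]].
by rewrite mem_iota => ltj; apply: HU.
Qed.

Lemma span_lt_leq d d' g : (d <= d')%N -> span_lt d g -> span_lt d' g.
Proof.
move=> ledd'; apply: span_lt_min => [|j x ltj xs]; first exact: span_lt_submodule.
by apply: mem_span_lt => //; apply: leq_trans ledd'.
Qed.

Lemma span_ltX d k g : span_lt d g -> span_lt (d + k) (c ^+ k * g).
Proof.
move=> Hg; rewrite mulrC.
apply: (@span_lt_min d (fun g => span_lt (d + k) (g * c ^+ k)) g) => // [|j x ltj xs].
  exact: (submodule_mull _ (span_lt_submodule _)).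
have -> : c ^+ j * x * c ^+ k = c ^+ (j + k) * x by rewrite exprD; ring.
by apply: mem_span_lt; lia.
Qed.

Lemma span_ltS d g : span_lt d.+1 g ->
  exists2 v, in_span A s v & span_lt d (g - c ^+ d * v).
Proof.
have [W0 WD] := (span_submodule subA) s; have [Wd0 WdD] := span_lt_submodule d.
pose U g := exists2 v, in_span A s v & span_lt d (g - c ^+ d * v).
apply: (@span_lt_min _ U) => [|j x ltj xs].
  split=> [|a u v Aa [u' Hu Lu] [v' Hv Lv]]; first by exists 0; rewrite ?mulr0 ?subr0.
  exists (a * u' + v'); first exact: WD.
  suff -> : a * u + v - c ^+ d * (a * u' + v')
    = a * (u - c ^+ d * u') + (v - c ^+ d * v') by apply: WdD.
  by ring.
have [-> | nejd] := eqVneq j d.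
  by exists x; rewrite ?subrr //; apply: (mem_span subA).
by exists 0; rewrite // mulr0 subr0; apply: mem_span_lt => //; lia.
Qed.

Lemma span_adjoin_lt g : in_span (adjoin A c) s g -> exists d, span_lt d g.
Proof.
pose V g := exists d, span_lt d g; have sV : submodule A V.
  split=> [|a u v Aa [d Hu] [d' Hv]]; first by exists 0%N.
  exists (maxn d d'); case: (span_lt_submodule (maxn d d')) => _; apply=> //.
    by apply: span_lt_leq Hu; lia.
  by apply: span_lt_leq Hv; lia.
apply: (@span_min _ V).
  split=> [|a u v Ha Vu Vv]; first by case: sV.
  apply: (submoduleD subA) => //; apply: (@adjoin_min (fun x => V (x * u)) a) => // [|j].
    exact: (submodule_mull u sV).
  by case: Vu => d Hu; exists (d + j)%N; apply: span_ltX.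
by move=> x xs; exists 1%N; rewrite -[x]mul1r; apply: (@mem_span_lt 1 0).
Qed.

End Generator.

Lemma noetherian_adjoin c : noetherian_sub A -> noetherian_sub (adjoin A c).
Proof.
move=> noethA U s [U0 UD] Us.
have sU : submodule A U by split=> // a u v Aa; apply: UD; apply: sub_adjoin.
have UX k u : U u -> U (c ^+ k * u).
  by move=> Uu; rewrite -[_ * u]addr0; apply: UD => //; apply: adjoinX.
(* Hilbert's basis argument: [L d] consists of the leading coefficients of the
   elements of [U] of degree [d] in [c]. *)
pose L d v := exists2 u, U u & span_lt c s d (u - c ^+ d * v).
have L_leq d d' v : (d <= d')%N -> L d v -> L d' v.
  move=> /subnK/esym Ed' [u Uu Hu]; exists (c ^+ (d' - d) * u); first exact: UX.
  have /(span_ltX (d' - d)) := Hu; rewrite addnC -Ed'.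
  suff -> : c ^+ (d' - d) * (u - c ^+ d * v) = c ^+ (d' - d) * u - c ^+ d' * v by [].
  by rewrite [in c ^+ d']Ed' exprD; ring.
have LD d a u v : A a -> L d u -> L d v -> L d (a * u + v).
  move=> Aa [u' Uu' Hu] [v' Uv' Hv]; exists (a * u' + v'); first exact: sU.2.
  have -> : a * u' + v' - c ^+ d * (a * u + v)
    = a * (u' - c ^+ d * u) + (v' - c ^+ d * v) by ring.
  exact: (span_lt_submodule c s d).2.
have [||t [tL Lt]] := noethA (fun v => in_span A s v /\ exists d, L d v) s.
- split=> [|a u v Aa [su [d Lu]] [sv [d' Lv]]].
    by split; [apply: (span_submodule subA s).1 | exists 0%N, 0; rewrite // mulr0 subrr].
  split; first exact: (span_submodule subA s).2.
  by exists (maxn d d'); apply: LD => //; [apply: L_leq Lu | apply: L_leq Lv]; lia.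
- by move=> g [].
(* Multiplication by [c] keeps a leading coefficient and raises the degree, so the finitely many
   generators [t] all occur in one common degree [D]. *)
have [D tLD] : exists D, forall x, x \in t -> L D x.
  elim: t tL {Lt} => [|x t IHt] tL; first by exists 0%N.
  have [y yt|D LD'] := IHt; first by apply: tL; rewrite inE yt orbT.
  have [_ [d Lx]] := tL x (mem_head _ _).
  exists (maxn d D) => y; rewrite inE => /predU1P[->|/LD' Ly].
    by apply: L_leq Lx; lia.
  by apply: L_leq Ly; lia.
(* Combinations of finitely many elements [r] of [U] realise every leading coefficient in degree
   [D]. *)
have [r [rU Hr]] : exists r, (forall x, x \in r -> U x) /\
    forall v, in_span A t v -> exists2 w, in_span A r w & span_lt c s D (w - c ^+ D * v).
  elim: t tLD {tL Lt} => [|x t IHt] tLD.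
    exists [::]; split=> // v ->; exists 0 => //.
    by rewrite mulr0 subr0; apply: (span_lt_submodule c s D).1.
  have [y yt|r [rU Hr]] := IHt; first by apply: tLD; rewrite inE yt orbT.
  have [u Uu Hu] := tLD x (mem_head _ _).
  exists (u :: r); split=> [y|v [a Aa /Hr[w rw Hw]]].
    by rewrite inE => /predU1P[->|/rU].
  exists (a * u + w); first by exists a; rewrite // addrAC subrr add0r.
  have -> : a * u + w - c ^+ D * v
    = a * (u - c ^+ D * x) + (w - c ^+ D * (v - a * x)) by ring.
  exact: (span_lt_submodule c s D).2.
(* The part of [U] of degree below [D] lies in a finitely generated [A]-module, so it has finitely
   many generators [q]. *)
have [||q [qU Uq]] := noethA (fun g => U g /\ span_lt c s D g)
    [seq c ^+ j * x | j <- iota 0 D, x <- s].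
- split=> [|a u v Aa [Uu Hu] [Uv Hv]].
    by split=> //; apply: (span_lt_submodule c s D).1.
  by split; [apply: sU.2 | apply: (span_lt_submodule c s D).2].
- by move=> g [].
have subA' := adjoin_subring c.
have sA' a : A a -> adjoin A c a by apply: sub_adjoin.
exists (q ++ r); split=> [x|g Ug].
  by rewrite mem_cat => /orP[/qU[]|/rU].
have [d Hg] := span_adjoin_lt (Us g Ug).
(* In degree at least [D], subtracting a power of [c] times a combination of [r] cancels the leading
   term; below [D], the list [q] suffices. *)
elim: d g Hg Ug => [|d IHd] g Hg Ug.
  by rewrite Hg; apply: (span_submodule subA' _).1.
have [ltdD|leDd] := ltnP d D.
  apply: (@span_mono A) => //; apply: (@span_sub A subA q) => [x xq|].
    by rewrite mem_cat xq.
  by apply: Uq; split=> //; apply: span_lt_leq Hg.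
have [v sv Hv] := span_ltS Hg.
have [|w rw Hw] := Hr v.
  by apply: Lt; split=> //; exists d, g.
have Uw : U w by apply: span_min rw.
have -> : g = c ^+ (d - D) * w + (g - c ^+ (d - D) * w) by ring.
apply: (span_submodule subA' _).2; first exact: adjoinX.
  apply: (@span_mono A) => //; apply: (@span_sub A subA r) => // x xr.
  by rewrite mem_cat xr orbT.
apply: IHd; last by apply: (submoduleB subA) => //; apply: UX.
have -> : g - c ^+ (d - D) * w
  = (g - c ^+ d * v) - c ^+ (d - D) * (w - c ^+ D * v).
  by rewrite -[in c ^+ d](subnK leDd) exprD; ring.
apply: (submoduleB subA (span_lt_submodule c s d)) => //.
by have /(span_ltX (d - D)) := Hw; rewrite addnC subnK.
Qed.

End Adjoin.

(** Induction on the generators [x :: s]: the elements of [U] in the span of [s] are handled by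
    induction, and the possible coefficients at [x] of elements of [U] form an ideal of [R], which
    is finitely generated. *)
Lemma noetherian_image (R : comUnitRingType) (h : {rmorphism R -> C}) :
  noetherian R -> noetherian_sub (fun x => exists r, x = h r).
Proof.
move=> noethR; set A := fun x => _.
have subA : subring A.
  split; first by exists 1; rewrite rmorph1.
    by move=> _ _ [a ->] [b ->]; exists (a - b); rewrite rmorphB.
  by move=> _ _ [a ->] [b ->]; exists (a * b); rewrite rmorphM.
move=> U s; elim: s U => [|x s IHs] U sU Us; first by exists [::].
have [||t [tU Ut]] := IHs (fun g => U g /\ in_span A s g).
- split; first by split; [case: sU | apply: (span_submodule subA s).1].
  move=> a u v Aa [Uu su] [Uv sv].
  by split; [apply: sU.2 | apply: (span_submodule subA s).2].
- by move=> g [].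
pose I (a : R) := exists2 u, U u & in_span A s (u - h a * x).
have I_ideal : is_ideal I.
  split=> [|a b b' [u Uu Hu] [v Uv Hv]].
    exists 0; first by case: sU.
    by rewrite rmorph0 mul0r subr0; apply: (span_submodule subA s).1.
  exists (h a * u + v); first by apply: sU.2 => //; exists a.
  have -> : h a * u + v - h (a * b + b') * x
    = h a * (u - h b * x) + (v - h b' * x) by rewrite rmorphD rmorphM; ring.
  by apply: (span_submodule subA s).2 => //; exists a.
have [e He] := noethR I I_ideal.
(* Each generator of the ideal of coefficients is lifted to an element of [U]. *)
have [r [rU Hr]] : exists r, (forall y, y \in r -> U y) /\
    forall c : 'I_(size e) -> R,
      exists2 w, in_span A r w & in_span A s (w - h (\sum_i c i * e`_i) * x).
  have : forall i : 'I_(size e), I e`_i.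
    move=> i; apply/He; exists (fun j => (j == i)%:R).
    rewrite (bigD1 i) //= eqxx mul1r big1 ?addr0 // => j /negPf ->.
    by rewrite mul0r.
  elim: e {He} => [|b e IHe] eI.
    exists [::]; split=> // c; exists 0 => //.
    by rewrite big_ord0 rmorph0 mul0r subr0; apply: (span_submodule subA s).1.
  have [i|r [rU Hr]] := IHe; first exact: (eI (lift ord0 i)).
  have [u Uu Hu] := eI ord0.
  exists (u :: r); split=> [y|c]; first by rewrite inE => /predU1P[->|/rU].
  have [w rw Hw] := Hr (fun i => c (lift ord0 i)).
  exists (h (c ord0) * u + w).
    by exists (h (c ord0)); [exists (c ord0) | rewrite addrAC subrr add0r].
  rewrite big_ord_recl rmorphD rmorphM /=; set f := \sum_(i < _) _.
  have -> : h (c ord0) * u + w - (h (c ord0) * h b + h f) * x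
    = h (c ord0) * (u - h b * x) + (w - h f * x) by ring.
  by apply: (span_submodule subA s).2 => //; exists (c ord0).
exists (t ++ r); split=> [y|g Ug].
  by rewrite mem_cat => /orP[/tU[]|/rU].
have [_ [a ->] sg] := Us g Ug.
have [|c Ea] := (He a).1; first by exists g.
have [w rw Hw] := Hr c; rewrite -Ea in Hw.
have Uw : U w by apply: span_min rw.
rewrite -[g](subrK w); apply: submoduleD; [exact: subA | exact: span_submodule | |].
  apply: (@span_sub A subA t) => [y yt|]; first by rewrite mem_cat yt.
  apply: Ut; split; first exact: (submoduleB subA sU).
  have -> : g - w = (g - h a * x) - (w - h a * x) by ring.
  exact: (submoduleB subA (span_submodule subA s) sg Hw).
by apply: (@span_sub A subA r) => // y yr; rewrite mem_cat yr orbT.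
Qed.

End Span.

(** * Local rings with infinite residue field *)

Section Local.
Variables (R : comUnitRingType) (m : idealr R).

(** Zorn's lemma for the proper ideals that contain [I]. *)
Lemma ideal_sub_maximal (I : R -> Prop) : is_ideal I -> ~ I 1 ->
  exists2 J : idealr R, maximal_ideal J & forall x, I x -> x \in J.
Proof.
move=> idI I1.
(* The empty set is admitted as the union of the empty chain. *)
pose P (X : R -> Prop) := (forall a, ~ X a) \/
  [/\ is_ideal X, ~ X 1 & forall a, I a -> X a].
have [F FP Ftot|M [PM Mmax]] := @classical_sets.Zorn_bigcup R P.
  have [[X [FX [a Xa]]]|F0] := boolp.pselect (exists X, F X /\ exists a, X a); last first.
    by left=> a [X FX Xa]; apply: F0; exists X; split=> //; exists a.
  have FI Y b : F Y -> Y b -> [/\ is_ideal Y, ~ Y 1 & forall a, I a -> Y a].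
    by move=> /FP[Y0 /Y0|].
  right; split.
  - split; first by exists X => //; have [[]] := FI X a FX Xa.
    move=> b u v [Y FY Yu] [Z FZ Zv].
    case: (Ftot _ _ FY FZ) => [YZ|ZY].
      by exists Z => //; have [[_ ZD] _ _] := FI Z v FZ Zv; apply: ZD => //; apply: YZ.
    by exists Y => //; have [[_ YD] _ _] := FI Y u FY Yu; apply: YD => //; apply: ZY.
  - by move=> [Y FY Y1]; have [_ []] := FI Y 1 FY Y1.
  - by move=> b Ib; exists X => //; have [_ _] := FI X a FX Xa; apply.
have Mmax' N : P N -> (forall a, M a -> N a) -> forall a, N a -> M a.
  move=> PN MN; apply: boolp.contrapT => NM; by apply: (Mmax N) => //; split.
have [idM M1 IM] : [/\ is_ideal M, ~ M 1 & forall a, I a -> M a].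
  case: PM => // M0; exfalso; apply: (M0 0); apply: (Mmax' I).
  - by right.
  - by move=> a /M0.
  - by case: idI.
(* The type [idealr] asks for a boolean predicate, which classical logic provides. *)
pose S : {pred R} := fun a => boolp.asbool (M a).
have SP a : reflect (M a) (a \in S) by apply: boolp.asboolP.
have Sid : idealr_closed S.
  split; [by apply/SP; case: idM | by apply/SP |].
  by move=> a u v /SP Mu /SP Mv; apply/SP; apply: idM.2.
pose J : idealr R := HB.pack_for (idealr R) S (isIdealr.Build R S Sid).
exists J => [K JK a|x /IM Mx]; last exact/SP.
apply/idP/idP => [Ka|]; last exact: JK.
suff : M a by move/SP.
apply: (Mmax' (fun a => a \in K)) => //; last by move=> b /SP Mb; apply: JK.
right; split=> [||b /IM /SP Jb]; last exact: JK.
  by split=> [|b u v Ku Kv]; [apply: rpred0 | rewrite rpredD // idealMr].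
by rewrite idealr1.
Qed.

Hypothesis loc_m : local_ring_with m.

(** A nonunit generates a proper ideal, which lies in a maximal ideal, hence in [m]. *)
Lemma local_unitE x : (x \is a GRing.unit) = (x \notin m).
Proof.
apply/idP/idP => [/divrr x1|xm].
  apply/negP => xm; have := idealr1 m.
  by rewrite -x1 mulrC idealMr.
apply: contraT => xU; case/negP: xm.
have [||J maxJ xJ] := @ideal_sub_maximal (fun y => exists a, y = a * x).
- split=> [|a _ _ [b ->] [c ->]]; first by exists 0; rewrite mul0r.
  by exists (a * b + c); ring.
- case=> a ax1; case/negP: xU; apply/unitrP; exists a.
  by rewrite -ax1 mulrC.
by rewrite -(loc_m.2 J maxJ); apply: xJ; exists 1; rewrite mul1r.
Qed.

Lemma local_unitNP x : reflect (x \in m) (x \isn't a GRing.unit).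
Proof. by rewrite local_unitE negbK; apply: idP. Qed.

(** A unit value makes the reduction of [p] modulo [m] nonzero, so that it has finitely many roots
    in the residue field. The root count is carried out over [R], by induction on the size of
    [p]. *)
Lemma unit_value_roots (p : {poly R}) a : p.[a] \is a GRing.unit ->
  exists s : seq R, forall t, p.[t] \isn't a GRing.unit ->
    exists2 b, b \in s & t - b \in m.
Proof.
have [k] := ubnP (size p); elim: k => // k IHk in p *; rewrite ltnS => szp pa.
have [[b pb]|nroot] := boolp.pselect (exists b, p.[b] \in m); last first.
  by exists [::] => t /local_unitNP pt; case: nroot; exists t.
have pb_n : p.[b] \isn't a GRing.unit by apply/local_unitNP.
(* A root [b] modulo [m] becomes an exact root once the constant [p.[b]], which lies in [m], is
   subtracted. *)
have /factor_theorem[q Dq] : root (p - p.[b]%:P) b by rewrite rootE !hornerE subrr.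
have Dp t : p.[t] = q.[t] * (t - b) + p.[b].
  by rewrite -[p in LHS](subrK p.[b]%:P) Dq !hornerE.
have p0 : p != 0 by apply: contraTneq pa => ->; rewrite horner0 unitr0.
have q0 : q != 0.
  by apply: contraNneq pb_n => q0; move: pa; rewrite Dp q0 horner0 mul0r add0r.
have szq : (size q < k)%N.
  apply: leq_trans szp; have := size_polyD p (- p.[b]%:P).
  rewrite Dq size_Mmonic ?monicXsubC // size_XsubC addn2 /= size_polyN size_polyC.
  by rewrite (maxn_idPl (leq_trans (leq_b1 _) _)) ?size_poly_gt0.
have [|s Hs] := IHk q szq.
  rewrite local_unitE; apply: contraL pa => qm.
  by rewrite local_unitE negbK Dp rpredD // mulrC idealMr.
exists (b :: s) => t /local_unitNP; rewrite Dp => ptm.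
have {ptm} qtm : q.[t] * (t - b) \in m by rewrite -(rpredDr _ pb).
have [qt_u|/Hs[c cs tc]] := boolP (q.[t] \is a GRing.unit); last first.
  by exists c; rewrite // inE cs orbT.
by exists b; rewrite ?mem_head // -(mulKr qt_u (t - b)) idealMr.
Qed.

Hypothesis inf_m : infinite_type {ideal_quot m}.

(** The bad parameters of all members of [P] fill only finitely many residue classes; any
    representative of another class works. *)
Lemma exists_unit_values (P : seq {poly R}) :
  (forall p, p \in P -> exists a, p.[a] \is a GRing.unit) ->
  exists t, forall p, p \in P -> p.[t] \is a GRing.unit.
Proof.
move=> PU; have [s Hs] : exists s : seq R, forall p t, p \in P ->
    p.[t] \isn't a GRing.unit -> exists2 b, b \in s & t - b \in m.
  elim: P PU => [|p P IHP] PU; first by exists [::].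
  have [|s Hs] := IHP; first by move=> q qP; apply: PU; rewrite inE qP orbT.
  have [a pa] := PU p (mem_head _ _); have [s' Hs'] := unit_value_roots pa.
  exists (s' ++ s) => q t; rewrite inE => /predU1P[->|qP] qt.
    by have [b bs tb] := Hs' t qt; exists b; rewrite // mem_cat bs.
  by have [b bs tb] := Hs q t qP qt; exists b; rewrite // mem_cat bs orbT.
have [x xs] := inf_m (map (\pi_({ideal_quot m})%qT) s).
exists (repr x) => p pP; apply: contraNT xs => /(Hs p _ pP)[b bs].
by rewrite Quotient.idealrBE reprK => /eqP ->; apply: map_f.
Qed.

Lemma exists_unit_dets (n : nat) (T : eqType) (g : T -> 'I_n -> 'M[R]_n)
    (P : seq T) : (forall t i, g t i \in unitmx) ->
  exists L : 'M[R]_n, forall t, t \in P ->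
    \matrix_(i, j) (L *m g t i) i j \in unitmx.
Proof.
move=> gU; pose N L t := \matrix_(i, j) (L *m g t i) i j.
have NE L t i j : N L t i j = (L *m g t i) i j by rewrite mxE.
elim: P => [|t P [L LP]]; first by exists 0.
(* Row [i] of [L'] undoes [g t i], which turns the matrix attached to [t] into the identity. *)
pose L' := \matrix_(i, j) invmx (g t i) i j.
(* On the line from [L] to [L'] every determinant is a polynomial in the
   parameter: unit at 0 for the members of [P], and equal to 1 at 1 for [t]. *)
pose pol s := \det (\matrix_(i, j)
  ((N L s i j)%:P + 'X * (N L' s i j - N L s i j)%:P)).
have polE s x : (pol s).[x] = \det (N (L + x *: (L' - L)) s).
  rewrite -horner_evalE -det_map_mx; congr (\det _); apply/matrixP => i j.
  rewrite [LHS]mxE /= horner_evalE [X in X.[_]]mxE !hornerE !NE.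
  rewrite mulmxDl -scalemxAl mulmxBl [RHS]mxE [X in _ = _ + X]mxE.
  by rewrite [X in _ = _ + _ * X]mxE [X in _ = _ + _ * (_ + X)]mxE.
have [p|x Hx] := @exists_unit_values (map pol (t :: P)).
  case/mapP=> s; rewrite inE => /predU1P[-> ->|sP ->].
    exists 1; rewrite polE scale1r addrCA subrr addr0.
    suff -> : N L' t = 1%:M by rewrite det1 unitr1.
    apply/matrixP => i j; rewrite mxE -(mulVmx (gU t i)) !mxE.
    by apply: eq_bigr => k _; rewrite mxE.
  by exists 0; rewrite polE scale0r addr0; apply: LP.
exists (L + x *: (L' - L)) => s sP; rewrite unitmxE -polE.
exact/Hx/map_f.
Qed.

End Local.

(** * Properties of families that are multiplicative in each entry *)

Definition upd (n : nat) (S : Type) (a : 'I_n -> S) i u : 'I_n -> S :=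
  fun j => if j == i then u else a j.

Section Slotwise.
Variables (n : nat) (S : comNzRingType) (Q : ('I_n -> S) -> Prop).
Hypothesis Q_mul : forall a i u v,
  Q (upd a i u) -> Q (upd a i v) -> Q (upd a i (u * v)).

Lemma slotwise_prod (G : finType) (l : 'I_n -> G -> S) : (0 < #|G|)%N ->
  (forall g : 'I_n -> G, Q (fun i => l i (g i))) ->
  Q (fun i => \prod_g l i g).
Proof.
move=> /card_gt0P[g0 _] Ql; pose f i := \prod_g l i g.
(* The entries in [r] already carry their full product, the others a single factor. The choice [g]
   stays general because the induction changes it at the next entry. *)
suff Qr (r : seq 'I_n) g : Q (fun i => if i \in r then f i else l i (g i)).
  have -> : (fun i => \prod_g l i g) =
      (fun i => if i \in enum 'I_n then f i else l i g0).
    by apply: boolp.funext => i; rewrite mem_enum.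
  exact: (Qr _ (fun=> g0)).
elim: r g => [|i r IHr] g; first exact: Ql.
pose a j := if j \in r then f j else l j (g j).
have -> : (fun j => if j \in i :: r then f j else l j (g j)) = upd a i (f i).
  by apply: boolp.funext => j; rewrite /upd /a inE; case: eqVneq => [->|].
have [ir|ir] := boolP (i \in r).
  suff -> : upd a i (f i) = a by apply: IHr.
  by apply: boolp.funext => j; rewrite /upd /a; case: eqVneq => [->|]; rewrite ?ir.
have Qa h : Q (upd a i (l i h)).
  suff -> : upd a i (l i h) =
    (fun j => if j \in r then f j else l j (upd g i h j)) by apply: IHr.
  apply: boolp.funext => j; rewrite /upd /a; case: eqVneq => [->|//].
  by rewrite (negPf ir).
(* The product is built up from one factor, as [Q] is not assumed to hold with an entry 1. *)
rewrite /f; have : index_enum G != [::].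
  by have := mem_index_enum g0; case: (index_enum G).
elim: (index_enum G) => // h [|h' s] IHs _; first by rewrite big_seq1; apply: Qa.
by rewrite big_cons; apply: Q_mul => //; apply: IHs.
Qed.

End Slotwise.

(** * Ideals generated by subfamilies, regular sequences and radicals *)

Section Ideals.
Variables (n : nat) (S : comNzRingType).
Implicit Types (a b : 'I_n -> S) (T : {set 'I_n}) (i j : 'I_n) (h u v w : S).

Definition ideal_of a T h : Prop :=
  exists c : 'I_n -> S, h = \sum_(i in T) c i * a i.

Lemma ideal_of0 a T : ideal_of a T 0.
Proof. by exists (fun=> 0); rewrite big1 // => i _; rewrite mul0r. Qed.

Lemma ideal_ofD a T u v : ideal_of a T u -> ideal_of a T v -> ideal_of a T (u + v).
Proof.
move=> [c ->] [d ->]; exists (fun i => c i + d i).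
by rewrite -big_split; apply: eq_bigr => i _; rewrite mulrDl.
Qed.

Lemma ideal_ofMl a T w u : ideal_of a T u -> ideal_of a T (w * u).
Proof.
move=> [c ->]; exists (fun i => w * c i).
by rewrite mulr_sumr; apply: eq_bigr => i _; rewrite mulrA.
Qed.

Lemma ideal_ofMr a T w u : ideal_of a T u -> ideal_of a T (u * w).
Proof. by rewrite mulrC; apply: ideal_ofMl. Qed.

Lemma ideal_ofB a T u v : ideal_of a T u -> ideal_of a T v -> ideal_of a T (u - v).
Proof. by move=> Hu Hv; rewrite -mulN1r; apply/ideal_ofD/ideal_ofMl. Qed.

Lemma ideal_of_sum a T (I : Type) (r : seq I) (P : pred I) (F : I -> S) :
  (forall k, P k -> ideal_of a T (F k)) -> ideal_of a T (\sum_(k <- r | P k) F k).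
Proof.
by move=> HF; elim/big_ind: _ => //; [apply: ideal_of0 | apply: ideal_ofD].
Qed.

Lemma mem_ideal_of a T i : i \in T -> ideal_of a T (a i).
Proof.
move=> iT; exists (fun j => (j == i)%:R); rewrite (bigD1 i) //= eqxx mul1r.
by rewrite big1 ?addr0 // => j /andP[_ /negPf ->]; rewrite mul0r.
Qed.

Lemma ideal_of_trans a b T T' h : (forall i, i \in T -> ideal_of b T' (a i)) ->
  ideal_of a T h -> ideal_of b T' h.
Proof.
by move=> ab [c ->]; apply: ideal_of_sum => i iT; apply/ideal_ofMl/ab.
Qed.

Lemma eq_ideal_of a b T h : {in T, a =1 b} -> ideal_of a T h -> ideal_of b T h.
Proof.
by move=> eab; apply: ideal_of_trans => i iT; rewrite eab //; apply: mem_ideal_of.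
Qed.

Lemma ideal_ofD1P a T i h : i \in T ->
  ideal_of a T h <-> exists w, ideal_of a (T :\ i) (h - w * a i).
Proof.
move=> iT; split=> [[c ->]|[w Hw]].
  exists (c i), c; by rewrite (big_setD1 i) //= addrAC subrr add0r.
rewrite -(subrK (w * a i) h); apply/ideal_ofD/ideal_ofMl/mem_ideal_of => //.
by apply: ideal_of_trans Hw => j /setD1P[_ jT]; apply: mem_ideal_of.
Qed.

Lemma ideal_of_upd a T i u h : i \notin T -> ideal_of (upd a i u) T h <-> ideal_of a T h.
Proof.
by move=> iT; split; apply: eq_ideal_of => j jT; rewrite /upd;
  case: eqVneq => // ji; rewrite -ji jT in iT.
Qed.

(** Isolates the entry [u], leaving an ideal that does not depend on it. *)
Lemma ideal_of_updP a T i u h : i \in T ->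
  ideal_of (upd a i u) T h <-> exists w, ideal_of a (T :\ i) (h - w * u).
Proof.
move=> iT; rewrite (ideal_ofD1P _ _ iT) {2}/upd eqxx.
by split=> -[w]; rewrite ?ideal_of_upd ?setD11 // => Hw; exists w;
  rewrite ?ideal_of_upd ?setD11.
Qed.

(* All orderings of the [a i] are regular sequences, except that the quotient
   by all of them may vanish. *)
Definition perm_regular a : Prop :=
  forall T i h, i \notin T -> ideal_of a T (h * a i) -> ideal_of a T h.

(** The main case has [i] in [T]. Let [I] be generated by the other entries of [T], and let
    [h * a k] be [w * (u * v)] modulo [I]. Regularity of [a k] modulo [I] and [u] gives [h = e * u]
    modulo [I]; cancelling [u] puts [e * a k] in the ideal of [I] and [v]. Hence [e] lies there too,
    and [h] is a multiple of [u * v] modulo [I]. *)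
Lemma perm_regular_mul a i u v : perm_regular (upd a i u) ->
  perm_regular (upd a i v) -> perm_regular (upd a i (u * v)).
Proof.
have updE w : upd a i w i = w by rewrite /upd eqxx.
have updN w k : k != i -> upd a i w k = a k by rewrite /upd => /negPf ->.
move=> Hu Hv T k h kT.
have [Ek|nki] := eqVneq k i.
  rewrite {k}Ek in kT *; rewrite updE !ideal_of_upd // mulrA => Hh.
  have := Hu T i h kT; rewrite updE !ideal_of_upd //; apply.
  by have := Hv T i (h * u) kT; rewrite updE !ideal_of_upd //; apply.
rewrite updN //; have [iT|iT] := boolP (i \in T); last first.
  by rewrite !ideal_of_upd //; have := Hu T k h kT; rewrite updN // !ideal_of_upd.
have iTi : i \notin T :\ i by rewrite setD11.
have kTi : k \notin T :\ i by rewrite inE negb_and kT orbT.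
rewrite !ideal_of_updP // => -[w Hw].
have : ideal_of (upd a i u) T (h * upd a i u k).
  by rewrite ideal_of_updP // updN //; exists (w * v); rewrite mulrAC -mulrA.
move=> /(Hu _ _ _ kT); rewrite ideal_of_updP // => -[e He].
have : ideal_of a (T :\ i) ((e * a k - w * v) * u).
  have -> : (e * a k - w * v) * u
    = (h * a k - w * (u * v)) - a k * (h - e * u) by ring.
  exact/ideal_ofB/ideal_ofMl.
rewrite -(ideal_of_upd a u _ iTi) => Heu.
have := Hu _ _ (e * a k - w * v) iTi; rewrite updE => /(_ Heu).
rewrite ideal_of_upd // => Hew.
have : ideal_of (upd a i v) T (e * upd a i v k).
  by rewrite ideal_of_updP // updN //; exists w.
move=> /(Hv _ _ _ kT); rewrite ideal_of_updP // => -[z Hz].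
exists z; have -> : h - z * (u * v) = (h - e * u) + u * (e - z * v) by ring.
exact/ideal_ofD/ideal_ofMl.
Qed.

Definition in_radical (x : S) a : Prop := exists N, ideal_of a [set: 'I_n] (x ^+ N).

(** If one power of [x] is a multiple of [u] and another a multiple of [v] modulo the other entries,
    their product is a multiple of [u * v]. *)
Lemma in_radical_mul x a i u v : in_radical x (upd a i u) ->
  in_radical x (upd a i v) -> in_radical x (upd a i (u * v)).
Proof.
move=> [M HM] [N HN]; exists (M + N)%N; move: HM HN.
rewrite !ideal_of_updP ?inE // => -[w Hw] [z Hz]; exists (w * z).
have -> : x ^+ (M + N) - w * z * (u * v)
  = x ^+ N * (x ^+ M - w * u) + (w * u) * (x ^+ N - z * v) by rewrite exprD; ring.
by apply: ideal_ofD; apply: ideal_ofMl.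
Qed.

End Ideals.

(** * Linear forms and linear substitutions *)

Section LinearForms.
Variables (R : comUnitRingType) (n : nat).
Local Notation S := {mpoly R[n]}.
Implicit Types (A B : 'M[R]_n) (h p : S) (T : {set 'I_n}) (i j : 'I_n).

Lemma comp_mpoly_tnth k (f : k.-tuple S) (i : 'I_k) : 'X_i \mPo f = tnth f i.
Proof. by rewrite comp_mpolyXU (tnth_nth 0). Qed.

Lemma comp_mpoly_comp k (p : {mpoly R[k]}) (f : k.-tuple S) (g : n.-tuple S) :
  (p \mPo f) \mPo g = p \mPo [tuple tnth f i \mPo g | i < k].
Proof.
rewrite (comp_mpolyE p f) (comp_mpolyE p) raddf_sum; apply: eq_bigr => a _ /=.
rewrite comp_mpolyZ rmorph_prod; congr (_ *: _).
by apply: eq_bigr => i _; rewrite rmorphXn /= tnth_mktuple.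
Qed.

Definition lin_form A i : S := \sum_j A i j *: 'X_j.

Definition lin_sub A p : S := p \mPo [tuple lin_form A i | i < n].

Lemma lin_subX A i : lin_sub A 'X_i = lin_form A i.
Proof. by rewrite /lin_sub comp_mpoly_tnth tnth_mktuple. Qed.

Lemma lin_sub_form A B i : lin_sub B (lin_form A i) = lin_form (A *m B) i.
Proof.
rewrite {1}/lin_form {1}/lin_sub raddf_sum /=.
under eq_bigr => j _ do rewrite comp_mpolyZ [comp_mpoly _ _]lin_subX scaler_sumr.
rewrite exchange_big /=; apply: eq_bigr => k _.
by rewrite mxE scaler_suml; apply: eq_bigr => j _; rewrite scalerA.
Qed.

Lemma lin_form1 i : lin_form 1%:M i = 'X_i.
Proof.
rewrite /lin_form (bigD1 i) //= mxE eqxx scale1r big1 ?addr0 // => j.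
by rewrite mxE eq_sym => /negPf ->; rewrite scale0r.
Qed.

Lemma lin_sub_comp A B p : lin_sub B (lin_sub A p) = lin_sub (A *m B) p.
Proof.
rewrite /lin_sub comp_mpoly_comp; congr (_ \mPo _).
by apply: eq_mktuple => i; rewrite tnth_mktuple [LHS]lin_sub_form.
Qed.

Lemma lin_sub1 p : lin_sub 1%:M p = p.
Proof.
rewrite -[RHS]comp_mpoly_id; congr (_ \mPo _).
by apply: eq_mktuple => i; rewrite lin_form1.
Qed.

Lemma lin_form_homog A i : lin_form A i \is 1.-homog.
Proof.
by apply: rpred_sum => j _; apply: rpredZ; rewrite dhomogX /= mdeg1.
Qed.

Lemma mulX_eq0 h i : h * 'X_i = 0 -> h = 0.
Proof.
move=> hX; apply/mpolyP => a; rewrite -(mcoeffMX _ U_(i)) hX !mcoeff0 //.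
Qed.

(** Setting the variables in [T] to 0 changes a polynomial only by an element of their ideal. It
    sends [h * 'X_i] to 0 and fixes ['X_i], so it sends [h] to 0. *)
Lemma perm_regular_X : perm_regular (fun i => 'X_i : S).
Proof.
move=> T i h iT; pose e : n.-tuple S := [tuple if j \in T then 0 else 'X_j | j < n].
have eX j : 'X_j \mPo e = if j \in T then 0 else 'X_j.
  by rewrite comp_mpoly_tnth tnth_mktuple.
have sub_e p : ideal_of (fun j => 'X_j) T (p - (p \mPo e)).
  rewrite {1}[p]mpolyE comp_mpolyE -sumrB; apply: ideal_of_sum => a _ /=.
  rewrite -scalerBr -mul_mpolyC; apply: ideal_ofMl.
  rewrite mpolyXE_id; elim/big_ind2: _ => [||j _].
  - by rewrite subrr; apply: ideal_of0.
  - move=> u u' v v' Hu Hv.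
    have -> : u * v - u' * v' = (u - u') * v + u' * (v - v') by ring.
    by apply: ideal_ofD; [apply: ideal_ofMr | apply: ideal_ofMl].
  rewrite tnth_mktuple; case: ifP => [jT|_]; last by rewrite subrr; apply: ideal_of0.
  case: (a j) => [|k]; first by rewrite subrr; apply: ideal_of0.
  by rewrite expr0n subr0 exprS; apply/ideal_ofMr/mem_ideal_of.
case=> c /(congr1 (comp_mpoly e)); rewrite rmorphM /= eX (negPf iT) raddf_sum /=.
rewrite big1 => [/mulX_eq0 he|j jT]; last by rewrite rmorphM /= eX jT mulr0.
by have := sub_e h; rewrite he subr0.
Qed.

Lemma ideal_of_sub A a T h : ideal_of a T h ->
  ideal_of (fun i => lin_sub A (a i)) T (lin_sub A h).
Proof.
move=> [c ->]; exists (fun i => lin_sub A (c i)).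
by rewrite /lin_sub raddf_sum; apply: eq_bigr => i _; rewrite /= rmorphM.
Qed.

(** An invertible linear substitution is an automorphism that carries the variables to the given
    forms, so the claims reduce to those for the variables. *)
Lemma lin_form_system A : A \in unitmx ->
  perm_regular (lin_form A) /\ forall j, in_radical 'X_j (lin_form A).
Proof.
move=> Au.
have XA : (fun i => lin_sub A 'X_i) = lin_form A.
  by apply: boolp.funext => i; rewrite lin_subX.
have AX : (fun i => lin_sub (invmx A) (lin_form A i)) = (fun i => 'X_i).
  by apply: boolp.funext => i; rewrite lin_sub_form mulmxV // lin_form1.
split=> [T i h iT /(ideal_of_sub (invmx A))|j].
  rewrite AX /lin_sub rmorphM /= [X in _ * X]lin_sub_form mulmxV // lin_form1.
  move=> /(perm_regular_X iT)/(ideal_of_sub A).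
  by rewrite XA [lin_sub A _]lin_sub_comp mulVmx // lin_sub1.
exists 1%N; rewrite expr1 -(lin_form1 j) -(mulVmx Au) -lin_sub_form.
rewrite -XA; apply: ideal_of_sub; exists (fun i => (invmx A j i)%:MP).
by apply: eq_big => [i|i _]; rewrite ?inE // mul_mpolyC.
Qed.

End LinearForms.

(** * Algebraic independence from regularity *)

Section AlgebraicIndependence.
Variables (R : comUnitRingType) (n k : nat) (f : k.-tuple {mpoly R[n]}).
Hypotheses (f_reg : perm_regular (tnth f)) (f0 : forall i, (tnth f i)@_0 = 0).

(** Induction on the size of [T], then on the degree of [a]. If [a] involves ['X_j], write
    [p = q * 'X_j + p0] with [p0] free of ['X_j]. Once [p0 \mPo f] is in the ideal, regularity of
    the [j]-th entry puts [q \mPo f] there, and the coefficient of [p] at [a] is one of [q] in lower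
    degree. *)
Lemma coeff_eq0_of_ideal (T : {set 'I_k}) (p : {mpoly R[k]}) (a : 'X_{1..k}) :
  ideal_of (tnth f) (~: T) (p \mPo f) -> (forall i, a i != 0%N -> i \in T) ->
  p@_a = 0.
Proof.
have [c] := ubnP #|T|; elim: c => // c IHc in T p a *; rewrite ltnS => szT.
have [d] := ubnP (mdeg a); elim: d => // d IHd in p a *; rewrite ltnS => szd Hp aT.
case: (pickP (fun j => a j != 0%N)) => [j aj|a0]; last first.
  have {a0} -> : a = 0%MM by apply/mnmP => i; have /negbFE/eqP -> := a0 i; rewrite mnm0E.
  (* For [a = 0], constant terms are compared: all elements of the ideal have constant term 0, and
     [p \mPo f] has that of [p]. *)
  have [c' /(congr1 (mcoeff 0%MM))] := Hp.
  rewrite [RHS]raddf_sum /= big1 => [pf0|i _]; last by rewrite rmorphM /= f0 mulr0.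
  apply: etrans pf0; rewrite comp_mpolyE {1}[p]mpolyE !raddf_sum /=.
  apply: eq_bigr => b _; rewrite !mcoeffZ mcoeffX; congr (_ * _).
  rewrite rmorph_prod /=; have [->|/eqP b0] := eqVneq b 0%MM.
    by rewrite big1 // => i _; rewrite mnm0E expr0 mcoeff1 eqxx.
  case: (pickP (fun i => b i != 0%N)) => [i bi|b_0]; last first.
    by case: b0; apply/mnmP => i; have /negbFE/eqP -> := b_0 i; rewrite mnm0E.
  by rewrite (bigD1 i) //= rmorphXn /= f0 expr0n (negPf bi) mul0r.
have jT := aT j aj.
pose p0 := \sum_(b <- msupp p | b j == 0%N) p@_b *: 'X_[b].
pose q := \sum_(b <- msupp p | b j != 0%N) p@_b *: 'X_[b - U_(j)].
have Dp : p = q * 'X_j + p0.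
  rewrite {1}[p]mpolyE (bigID (fun b : 'X_{1..k} => b j == 0%N)) addrC; congr (_ + _).
  rewrite mulr_suml; apply: eq_bigr => b bj.
  by rewrite -scalerAl -mpolyXD submK // lep1mP.
have Hp0 : ideal_of (tnth f) (~: T) (p0 \mPo f).
  rewrite /p0 raddf_sum; apply: ideal_of_sum => b /eqP bj /=.
  rewrite comp_mpolyZ.
  (* A monomial of [p0] with a variable outside [T] takes its value in the ideal; any other is
     supported in [T :\ j], where the induction on [T] makes its coefficient vanish. *)
  case: (pickP (fun i => (b i != 0%N) && (i \notin T))) => [i /andP[bi iT]|bT].
    rewrite comp_mpolyX -mul_mpolyC; apply: ideal_ofMl.
    rewrite (bigD1 i) //=; apply: ideal_ofMr; case: (b i) bi => // e _.
    by rewrite exprS; apply/ideal_ofMr/mem_ideal_of; rewrite inE.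
  suff -> : p@_b = 0 by rewrite scale0r; apply: ideal_of0.
  apply: (IHc (T :\ j)); first by rewrite (cardsD1 j T) jT in szT.
    apply: ideal_of_trans Hp => i iT; apply: mem_ideal_of.
    by move: iT; rewrite !inE; apply: contra => /andP[].
  move=> i bi; rewrite !inE; have := bT i; rewrite bi /= => /negbFE ->.
  by rewrite andbT; apply: contraNneq bi => ->; rewrite bj.
have -> : p@_a = q@_(a - U_(j)).
  have Uja : (U_(j) <= a)%MM by rewrite lep1mP.
  rewrite Dp mcoeffD -{1}(submK Uja) addmC mcoeffMX.
  rewrite [X in _ + X]raddf_sum /= [X in _ + X]big1 ?addr0 //.
  move=> b /eqP bj; rewrite mcoeffZ mcoeffX; case: eqVneq => [ba|]; last by rewrite mulr0.
  by rewrite -ba bj in aj.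
apply: IHd.
- by have := mdegD (a - U_(j)) U_(j); rewrite submK ?lep1mP // mdeg1; lia.
- apply: (f_reg (i := j)); first by rewrite inE jT.
  have -> : (q \mPo f) * tnth f j = (p \mPo f) - (p0 \mPo f).
    by rewrite [in p \mPo f]Dp comp_mpolyD rmorphM /= comp_mpoly_tnth addrK.
  exact: ideal_ofB.
- by move=> i; rewrite mnmBE => ai; apply: aT; apply: contraNneq ai => ->.
Qed.

Lemma alg_independent_of_regular : alg_independent f.
Proof.
move=> p pf0; apply/mpolyP => a; rewrite mcoeff0.
apply: (@coeff_eq0_of_ideal [set: 'I_k]); last by move=> i; rewrite inE.
by rewrite pf0; apply: ideal_of0.
Qed.

End AlgebraicIndependence.

(** * Finiteness of the polynomial ring over the parameters *)

Section Finiteness.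
Variables (R : comUnitRingType) (n k d : nat) (f : k.-tuple {mpoly R[n]}).
Variable A : {mpoly R[n]} -> Prop.
Hypotheses (f_homog : forall i, tnth f i \is d.-homog) (d_gt0 : (0 < d)%N).
Hypotheses (f_rad : forall j, in_radical 'X_j (tnth f)).
Hypotheses (subA : subring A) (AC : forall c, A c%:MP) (Af : forall i, A (tnth f i)).

Lemma monomial_in_ideal : exists M, forall a : 'X_{1..n}, (M <= mdeg a)%N ->
  ideal_of (tnth f) [set: 'I_k] 'X_[a].
Proof.
have [N HN] : exists N : 'I_n -> nat, forall j,
    ideal_of (tnth f) [set: 'I_k] ('X_j ^+ N j).
  exact: (fin_all_exists f_rad).
(* Pigeonhole: beyond this degree some exponent [a j] is at least [N j]. *)
exists (\sum_j N j).+1 => a; rewrite mdegE => ltNa.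
case: (pickP (fun j => N j <= a j)%N) => [j leNa|aN].
  rewrite mpolyXE_id (bigD1 j) //=; apply: ideal_ofMr.
  by rewrite -(subnK leNa) exprD; apply: ideal_ofMl.
move: ltNa; rewrite ltnNge leq_sum // => j _.
by have := aN j; lia.
Qed.

(** Monomials of degree below the bound [M] generate. A larger one is a combination of the entries
    of [f] with coefficients of lower degree, as in the graded Nakayama lemma, so induction on the
    degree applies. *)
Lemma span_monomials : exists s, forall g, in_span A s g.
Proof.
have [M HM] := monomial_in_ideal.
exists [seq 'X_[b] | b : 'X_{1..n < M}] => g.
set s := [seq _ | _ : _]; have sS := span_submodule subA s.
have sZ c u : in_span A s u -> in_span A s (c *: u).
  by rewrite -mul_mpolyC; exact: (submoduleM sS).
have s_sum (I : Type) (r : seq I) (P : pred I) (F : I -> {mpoly R[n]}) :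
    (forall i, P i -> in_span A s (F i)) -> in_span A s (\sum_(i <- r | P i) F i).
  move=> HF; elim/big_ind: _ => //; first by case: sS.
  by move=> u v; apply: (submoduleD subA sS).
suff sX a : in_span A s 'X_[a].
  by rewrite [g]mpolyE; apply: (s_sum) => a _; apply: (sZ).
have [e] := ubnP (mdeg a); elim: e => // e IHe in a *; rewrite ltnS => sze.
have [ltaM|leMa] := ltnP (mdeg a) M.
  by apply: (mem_span subA); apply/imageP; exists (BMultinom ltaM).
have [c Ec] := HM a leMa.
(* Projection to the degree of the monomial discards all terms of the wrong degree; [d > 0] then
   makes the remaining cofactors smaller. *)
have <- : pihomog mdeg (mdeg a) 'X_[a] = 'X_[a] :> {mpoly R[n]}.
  by rewrite pihomogX eqxx.
rewrite Ec raddf_sum /=; apply: (s_sum) => i _.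
rewrite [c i]mpolyE mulr_suml raddf_sum /=; apply: (s_sum) => b _.
rewrite -scalerAl linearZ /=; apply: (sZ).
have hom : 'X_[b] * tnth f i \is (mdeg b + d).-homog.
  by apply: dhomogM => //; rewrite dhomogX.
have [Eab|neab] := eqVneq (mdeg b + d)%N (mdeg a); last first.
  by rewrite (pihomog_ne0 neab hom); case: sS.
rewrite -Eab pihomog_dE // mulrC; apply: (submoduleM sS) => //.
by apply: IHe; lia.
Qed.

End Finiteness.

(** * Adjoining finitely many elements *)

Section AdjoinSeq.
Variables (C : comNzRingType) (A : C -> Prop).
Hypothesis subA : subring A.

Definition adjoin_seq (s : seq C) : C -> Prop := foldl (@adjoin C) A s.

Lemma adjoin_seqP (s : seq C) :
  [/\ subring (adjoin_seq s), forall a, A a -> adjoin_seq s a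
    & forall x, x \in s -> adjoin_seq s x].
Proof.
rewrite /adjoin_seq; elim: s A subA => [|x s IHs] B subB //=.
have [sub_s Bs xs] := IHs _ (adjoin_subring subB x).
split=> // [a Ba|y]; first exact/Bs/sub_adjoin.
by rewrite inE => /predU1P[->|/xs //]; apply/Bs/(adjoinX subB _ 1).
Qed.

Lemma noetherian_adjoin_seq s : noetherian_sub A -> noetherian_sub (adjoin_seq s).
Proof.
rewrite /adjoin_seq; elim: s A subA => [|x s IHs] B subB //= noethB.
by apply: IHs; [apply: adjoin_subring | apply: noetherian_adjoin].
Qed.

Lemma adjoin_seq_min (B : C -> Prop) s g : subring B ->
  (forall a, A a -> B a) -> (forall x, x \in s -> B x) -> adjoin_seq s g -> B g.
Proof.
move=> subB; rewrite /adjoin_seq; elim: s A => [|x s IHs] A' AB sB /=; first exact: AB.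
apply: IHs => [a|y ys]; last by apply: sB; rewrite inE ys orbT.
apply: adjoin_min => [|j]; last by apply: subringX => //; apply: sB; rewrite mem_head.
split=> [|b u v /AB Bb Bu Bv]; first exact: (subring0 subB).
by apply: subringD => //; apply: subringM.
Qed.

End AdjoinSeq.

(** * Orbit products and the system of parameters *)

Section Main.
Variables (R : comUnitRingType) (n : nat).
Local Notation S := {mpoly R[n]}.

Lemma prod_dhomog (I : Type) (s : seq I) (F : I -> S) :
  (forall i, F i \is 1.-homog) -> \prod_(i <- s) F i \is (size s).-homog.
Proof.
move=> HF; elim: s => [|i s IHs]; first by rewrite big_nil dhomog1.
by rewrite big_cons /= -add1n; apply: dhomogM.
Qed.

(** The subring generated by the constants and [f] is Noetherian and the polynomial ring is finite
    over it, so the submodule [U] is finitely generated. *)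
Lemma finite_over_submodule (U : S -> Prop) k (f : k.-tuple S) d :
  noetherian R -> (0 < d)%N -> (forall i, tnth f i \is d.-homog) ->
  (forall j, in_radical 'X_j (tnth f)) ->
  U 0 -> (forall u v, U u -> U v -> U (u + v)) ->
  (forall (p : {mpoly R[k]}) u, U u -> U ((p \mPo f) * u)) ->
  finite_over U f.
Proof.
move=> noethR d_gt0 f_homog f_rad U0 UD UM.
pose A0 (x : S) := exists r, x = mpolyC n r.
have subA0 : subring A0.
  split; first by exists 1; rewrite mpolyC1.
    by move=> _ _ [a ->] [b ->]; exists (a - b); rewrite mpolyCB.
  by move=> _ _ [a ->] [b ->]; exists (a * b); rewrite mpolyCM.
(* The subring obtained by adjoining is the one known to be Noetherian; its inclusion in [B] turns
   coefficients into values at [f]. *)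
pose B (x : S) := exists p : {mpoly R[k]}, x = p \mPo f.
have subB : subring B.
  split; first by exists 1; rewrite comp_mpoly1.
    by move=> _ _ [p ->] [q ->]; exists (p - q); rewrite comp_mpolyB.
  by move=> _ _ [p ->] [q ->]; exists (p * q); rewrite rmorphM.
have [subA A0A fA] := adjoin_seqP subA0 f.
have AB x : adjoin_seq A0 f x -> B x.
  apply: adjoin_seq_min => // [_ [r ->]|y /tnthP[i ->]].
    by exists r%:MP; rewrite comp_mpolyC.
  by exists 'X_i; rewrite comp_mpoly_tnth.
have noethA : noetherian_sub (adjoin_seq A0 f).
  by apply: noetherian_adjoin_seq => //; apply: noetherian_image.
have [||s Hs] := @span_monomials R n k d f _ f_homog d_gt0 f_rad subA.
- by move=> c; apply: A0A; exists c.
- by move=> i; apply: fA; apply: mem_tnth.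
have [||t [tU Ut]] := noethA U s; last 1 first.
- exists t; split=> // g /Ut/(span_sumP subA)[c [cA ->]].
  have [p Hp] : exists p : 'I_(size t) -> {mpoly R[k]}, forall i, c i = p i \mPo f.
    exact: (fin_all_exists (fun i => AB _ (cA i))).
  by exists p; apply: eq_bigr => i _; rewrite Hp.
- split=> // _ u v /AB[p ->] Uu Uv; apply: UD => //; exact: UM.
by move=> g _; apply: Hs.
Qed.

Variable G : {fset 'M[R]_n}.
Hypothesis hG : GL_subgroup G.

Lemma mxactE A (p : S) : mxact A p = lin_sub (invmx A) p.
Proof. by []. Qed.

Definition orbit_prod (L : 'M[R]_n) i : S := \prod_(A : G) lin_form (L *m val A) i.

(** Right multiplication by an element of [G] permutes the factors. *)
Lemma orbit_prod_invariant L i : invariants G (orbit_prod L i).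
Proof.
case: hG => G_unit _ GM _ B GB; rewrite mxactE /lin_sub rmorph_prod /=.
pose h (A : G) : G := insubd A (val A *m B).
have hE A : val (h A) = val A *m B by rewrite val_insubd GM // (valP A).
have h_inj : injective h.
  move=> A A' /(congr1 val); rewrite !hE => /(congr1 (mulmx^~ (invmx B))).
  by rewrite !mulmxK ?G_unit // => /val_inj.
rewrite (reindex_inj h_inj); apply: eq_bigr => A _.
by rewrite hE [LHS]lin_sub_form -!mulmxA mulmxV ?G_unit // mulmx1.
Qed.

Lemma orbit_prod_homog L i : orbit_prod L i \is #|` G|.-homog.
Proof.
rewrite cardfE cardT enumT; apply: prod_dhomog => A; exact: lin_form_homog.
Qed.

(** Each choice of one factor per product gives the forms of an invertible matrix; [slotwise_prod]
    passes from these to the full products. *)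
Lemma orbit_prod_system L :
  (forall g : {ffun 'I_n -> G}, \matrix_(i, j) (L *m val (g i)) i j \in unitmx) ->
  perm_regular (orbit_prod L) /\ forall j, in_radical 'X_j (orbit_prod L).
Proof.
move=> Lu; pose Q (a : 'I_n -> S) := perm_regular a /\ forall j, in_radical 'X_j a.
apply: (@slotwise_prod n S Q _ G (fun i A => lin_form (L *m val A) i)).
- move=> a i u v [Hu Xu] [Hv Xv]; split; first exact: perm_regular_mul.
  by move=> j; apply: in_radical_mul.
- by case: hG => _ G1 _ _; apply/card_gt0P; exists [` G1]%fset.
move=> g; have := lin_form_system (Lu (finfun g)).
suff -> : lin_form (\matrix_(i, j) (L *m val (finfun g i)) i j) =
  (fun i => lin_form (L *m val (g i)) i) by [].
by apply: boolp.funext => i; apply: eq_bigr => j _; rewrite mxE ffunE.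
Qed.

Lemma invariants_subring : subring (invariants G).
Proof.
split=> [A _|p q Hp Hq A GA|p q Hp Hq A GA]; rewrite mxactE /lin_sub.
- exact: comp_mpoly1.
- by rewrite comp_mpolyB -[in RHS](Hp A GA) -[in RHS](Hq A GA).
- by rewrite rmorphM /= -[in RHS](Hp A GA) -[in RHS](Hq A GA).
Qed.

Lemma invariants_comp k (f : k.-tuple S) (p : {mpoly R[k]}) :
  (forall i, invariants G (tnth f i)) -> invariants G (p \mPo f).
Proof.
move=> fG A GA; rewrite mxactE /lin_sub comp_mpoly_comp; congr (_ \mPo _).
apply: eq_from_tnth => i; rewrite tnth_mktuple; exact: fG.
Qed.

End Main.

Theorem corollary2p5 (R : comUnitRingType) (m : idealr R)
    (hnoeth : noetherian R) (hloc : local_ring_with m)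
    (n : nat) (G : {fset 'M[R]_n}) (hG : GL_subgroup G)
    (hinf : infinite_type {ideal_quot m}) :
  exists (k : nat) (f : k.-tuple {mpoly R[n]}),
    hsop (invariants G) f /\
    forall i : 'I_k, exists2 d : nat, (d <= #|` G|)%N & tnth f i \is d.-homog.
Proof.
have [G_unit G1 _ _] := hG.
(* One determinant condition for each way of assigning a group element to every row. *)
have [L HL] := @exists_unit_dets R m hloc hinf n _
  (fun (g : {ffun 'I_n -> G}) i => val (g i))
  (enum {ffun 'I_n -> G}) (fun g i => G_unit _ (valP (g i))).
have Lu (g : {ffun 'I_n -> G}) : \matrix_(i, j) (L *m val (g i)) i j \in unitmx.
  by apply: HL; rewrite mem_enum.
have [L_reg L_rad] := orbit_prod_system hG Lu.
pose f := [tuple orbit_prod G L i | i < n].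
have fE : tnth f = orbit_prod G L by apply: boolp.funext => i; rewrite tnth_mktuple.
have f_homog i : tnth f i \is #|` G|.-homog by rewrite fE; apply: orbit_prod_homog.
have f_inv i : invariants G (tnth f i) by rewrite fE; apply: orbit_prod_invariant.
have G_gt0 : (0 < #|` G|)%N by rewrite cardfs_gt0; apply/fset0Pn; exists 1%:M.
exists n, f; split; last by move=> i; exists #|` G|.
have subI := invariants_subring G.
split=> // [i||]; first by exists #|` G|.
  apply: alg_independent_of_regular => [|i]; first by rewrite fE.
  (* The constant term vanishes because the degree, the order of [G], is positive. *)
  by apply: (dhomog_nemf_coeff (f_homog i)); rewrite mf0 eq_sym -lt0n.
apply: (finite_over_submodule hnoeth G_gt0 f_homog).
- by rewrite fE.
- exact: (subring0 subI).
- by move=> u v; apply: (subringD subI).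
- by move=> p u Hu; apply: (subringM subI) => //; apply: invariants_comp.
Qed.
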